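(* Let $0<\alpha<1$ be a real number and let $k > 16^{1/\alpha}$ be an integer. Then there exists an infinite word $\mathbf{z}$ over an alphabet of size $k$ such that $\mathrm{sc}(\mathbf{z}) \leq \alpha$.
   Context: For finite words $x, x'$, let $\mathrm{lcs}(x,x')$ denote the length of a longest common subsequence of $x$ and $x'$ (a subsequence need not consist of consecutive letters). For two nonempty words $x,x'$ of the same length $|x|=|x'|$, their similarity is $s(x,x') := \mathrm{lcs}(x,x')/|x|$. A subword (factor) of a word is a block of consecutive letters of it. For an infinite word $\mathbf{z}$ (a sequence of letters indexed by the positive integers), its similarity coefficient is $$\mathrm{sc}(\mathbf{z}) := \sup\{ s(x,x') : xx' \text{ is a subword of } \mathbf{z},\ |x|=|x'|\geq 1 \}.$$ *)

(* Defs.v *)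
From mathcomp Require Import all_boot all_order all_algebra.
From mathcomp Require Import all_classical all_reals all_analysis.

Set Implicit Arguments.
Unset Strict Implicit.
Unset Printing Implicit Defensive.

Import Order.TTheory GRing.Theory Num.Theory.

Local Open Scope classical_set_scope.
Local Open Scope ring_scope.

(* No common subsequence is longer than x, so the bound on n loses nothing. *)
Definition lcs (A : finType) (x x' : seq A) : nat :=
  \max_(n < (size x).+1 | [exists w : n.-tuple A, subseq w x && subseq w x']) n.

Definition similarity (R : realType) (A : finType) (x x' : seq A) : R :=
  (lcs x x')%:R / (size x)%:R.

(* Infinite words are indexed from 0: z i is the (i+1)-st letter. *)
Definition subword (A : finType) (w : seq A) (z : nat -> A) : Prop :=
  exists i : nat, w = mkseq (fun j => z (i + j)%N) (size w).

Definition similarities (R : realType) (A : finType) (z : nat -> A) : set R :=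
  [set s | exists x x' : seq A,
    [/\ subword (x ++ x') z, size x = size x', (1 <= size x)%N
      & s = similarity R x x']].
Arguments similarities R {A} z _.

Definition sc (R : realType) (A : finType) (z : nat -> A) : R :=
  sup (similarities R z).

(* The supremum in sc is a genuine one: sup takes a default value only on
   sets that are empty or unbounded above. *)
Lemma has_sup_similarities (R : realType) (A : finType) (z : nat -> A) :
  has_sup (similarities R z).
Proof.
split.
  exists (similarity R [:: z 0%N] [:: z 1%N]), [:: z 0%N], [:: z 1%N].
  by split => //; exists 0%N.
exists 1 => _ [x [x' [_ _ x_gt0 ->]]].
rewrite /similarity ler_pdivrMr ?ltr0n// mul1r ler_nat /lcs.
by apply/bigmax_leqP => n _; rewrite -ltnS.
Qed.

(* Main.v *)
Require Import Defs.
From mathcomp Require Import all_boot all_order all_algebra.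
From mathcomp Require Import all_classical all_reals all_analysis.
From mathcomp Require Import zify.

Import Order.TTheory GRing.Theory Num.Theory.

(** The word comes from a counting argument in the style of Rosenfeld.  Put
  [t m = floor (alpha * m) + 1], and call a word dissimilar when every factor
  [x x'] of it with [|x| = |x'| = m > 0] has [lcs x x' < t m], that is,
  [lcs x x' <= alpha * m].  The hypothesis on [k] gives
  [16 ^ m <= k ^ t m] ([threshold_large]).

  For a fixed [x] of length [m], a word [x'] of length [m] with
  [lcs x x' >= l] is determined by the places of the common subsequence in [x]
  and in [x'], at most [2 ^ m] choices each, and by its [m - l] other letters
  ([word_count_lcs_ge]).  For [l = t m] this leaves at most
  [4 ^ m * k ^ m / k ^ t m <= (k / 4) ^ m] words [x'].

  Let [S n] be the number of dissimilar words of length [n].  The key estimate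
  is [S n.+1 >= (k / 2) * S n] ([dissimilar_count_growth]), by strong induction
  on [n].  Of the [k * S n] extensions by one letter, those which fail end in
  [x x'] with [lcs x x' >= t m] for some [m = |x| >= 1]; deleting [x'] leaves
  a dissimilar word of length [n + 1 - m] that contains [x], so there are at
  most [S (n + 1 - m) * (k / 4) ^ m] of them.  By induction
  [S (n + 1 - m) <= S n / (k / 2) ^ (m - 1)], hence this is at most
  [k * S n / 2 ^ (m + 1)], and the sum over [m] is at most [k * S n / 2].  The
  rate [k / 2] is thus reproduced, with the constant 16 leaving no slack.

  So dissimilar words of all lengths exist.  As prefixes of dissimilar words
  are dissimilar, compactness ([konig_words]) gives an infinite word all of
  whose prefixes are dissimilar. *)

(** * Words with a long common subsequence *)

Lemma lcs_geP (A : finType) (l : nat) (x x' : seq A) :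
  l <= lcs x x' -> exists w, [/\ size w = l, subseq w x & subseq w x'].
Proof.
rewrite /lcs => le_l.
have H0 : [exists w : (@ord0 (size x)).-tuple A, subseq w x && subseq w x'].
  by apply/existsP; exists [tuple]; rewrite !sub0seq.
move: le_l; rewrite (bigop.bigmax_eq_arg ord0) //; case: arg_maxnP => // i.
case/existsP => w /andP[wx wx'] _ le_li.
exists (take l w); split; first by rewrite size_takel ?size_tuple.
  exact: subseq_trans (take_subseq _ _) wx.
exact: subseq_trans (take_subseq _ _) wx'.
Qed.

(** Inverse to splitting a word into its letters on and off the mask [b]. *)
Fixpoint unmask (A : Type) (b : bitseq) (u v : seq A) : seq A :=
  match b, u, v with
  | true :: b', a :: u', _ => a :: unmask A b' u' v
  | false :: b', _, a :: v' => a :: unmask A b' u v'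
  | _, _, _ => [::]
  end.
Arguments unmask {A} b u v.

Lemma unmaskK (A : Type) (b : bitseq) (x : seq A) : size b = size x ->
  unmask b (mask b x) (mask (map negb b) x) = x.
Proof.
elim: b x => [|[] b IHb] [|a x] //= [szb]; last by rewrite IHb.
by rewrite IHb.
Qed.

Definition word_count (A : finType) (P : pred (seq A)) (n : nat) : nat :=
  #|[pred w : n.-tuple A | P w]|.
Arguments word_count {A} P n.

(** Such an [x'] is rebuilt from the mask of the common subsequence in [x], its
  mask in [x'], and the letters of [x'] off that mask, so it lies in the image
  of a set of size [2 ^ m * 2 ^ m * #|A| ^ (m - l)].  Multiplying by
  [#|A| ^ l] avoids a truncated exponent when [l] exceeds [m]. *)
Lemma word_count_lcs_ge (A : finType) (l m : nat) (x : seq A) : size x = m ->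
  word_count (fun x' => l <= lcs x x') m * #|A| ^ l <= 4 ^ m * #|A| ^ m.
Proof.
move=> szx.
have [lt_ml|le_lm] := ltnP m l.
  rewrite [word_count _ _]eq_card0 ?mul0n// => x'; rewrite !inE.
  apply/negP => /lcs_geP[w [szw /size_subseq]].
  by rewrite szw szx leqNgt lt_ml.
rewrite -[X in _ <= _ * #|A| ^ X](subnK le_lm) expnD mulnA leq_mul2r.
apply/orP; right.
have szx_eq : size x == m by apply/eqP.
pose glue (p : (m.-tuple bool * m.-tuple bool) * (m - l).-tuple A) :=
  insubd (Tuple szx_eq) (unmask p.1.2 (mask p.1.1 x) p.2).
have -> : 4 ^ m * #|A| ^ (m - l) =
    #|{: (m.-tuple bool * m.-tuple bool) * (m - l).-tuple A}|.
  by rewrite !card_prod !card_tuple card_bool -expnMn.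
apply: leq_trans (leq_image_card glue _).
apply/subset_leq_card/fintype.subsetP => x'; rewrite inE.
move=> /lcs_geP[w [szw /subseqP[b szb wb]]].
case/subseqP => b' szb' wb'.
have szb_eq : size b == m by rewrite szb szx.
have szb'_eq : size b' == m by rewrite szb' size_tuple.
have szv : size (mask (map negb b') x') == m - l.
  rewrite size_mask ?size_map ?szb'// -szw wb' size_mask// count_map.
  rewrite -(eqP szb'_eq) -(count_predC id b') addKn.
  by apply/eqP/eq_count => -[].
apply/fintype.imageP; exists (Tuple szb_eq, Tuple szb'_eq, Tuple szv) => //.
apply: val_inj; rewrite /glue /= -wb wb' unmaskK ?szb'//.
by rewrite val_insubd size_tuple eqxx.
Qed.

(** * Counting words *)

Lemma word_count_cat (A : finType) (P : pred (seq A)) (Q : rel (seq A))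
    (a b : nat) :
  word_count (fun w => P (take a w) && Q (take a w) (drop a w)) (a + b) =
  \sum_(u : a.-tuple A | P u) word_count (Q u) b.
Proof.
under [RHS]eq_bigr do rewrite /word_count -sum1_card.
rewrite pair_big_dep /= /word_count -sum1_card.
rewrite (reindex (fun p : a.-tuple A * b.-tuple A => cat_tuple p.1 p.2)) /=.
  apply: eq_bigl => -[u v].
  by rewrite !inE /= take_size_cat ?drop_size_cat ?size_tuple.
have szt (w : (a + b).-tuple A) : size (take a w) == a.
  by rewrite size_takel// size_tuple leq_addr.
have szd (w : (a + b).-tuple A) : size (drop a w) == b.
  by rewrite size_drop size_tuple addKn.
exists (fun w => (Tuple (szt w), Tuple (szd w))) => [[u v] _|w _].
  by congr pair; apply: val_inj;
    rewrite /= ?take_size_cat ?drop_size_cat ?size_tuple.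
by apply: val_inj; rewrite /= cat_take_drop.
Qed.

Lemma word_count_union_bound (A : finType) (n N : nat) (P Q : pred (seq A))
    (B : nat -> pred (seq A)) :
  (forall w, size w = n -> P w -> ~~ Q w -> exists2 i, i < N & B i w) ->
  word_count P n <= word_count Q n + \sum_(i < N) word_count (B i) n.
Proof.
move=> cover; rewrite /word_count -!sum1_card.
under [X in _ + X]eq_bigr do rewrite -sum1_card big_mkcond.
rewrite exchange_big /= [leqLHS]big_mkcond [X in X + _]big_mkcond -big_split /=.
apply: leq_sum => w _; rewrite !inE; case: ifP => // Pw.
have [//|nQw] := boolP (Q w).
have [i ltiN Biw] := cover w (size_tuple w) Pw nQw.
by rewrite add0n (bigD1 (Ordinal ltiN)) //= inE Biw.
Qed.

Lemma geometric_sum_le (N X : nat) (b : nat -> nat) :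
  (forall i, i < N -> b i * 2 ^ i.+2 <= X) -> 2 * \sum_(i < N) b i <= X.
Proof.
move=> bX; rewrite -(leq_pmul2r (expn_gt0 2 N)).
(* The bound by the partial geometric sum, sum <= (X / 2) (1 - 2^-N), written
   without subtraction so that it can be proved by induction on N. *)
suff: (\sum_(i < N) b i) * 2 ^ N.+1 + X <= X * 2 ^ N by rewrite expnS; nia.
elim: N bX => [|N IHN] bX; first by rewrite big_ord0 mul0n muln1.
have := IHN (fun i lti => bX i (leqW lti)); have := bX N (ltnSn N).
by rewrite big_ord_recr /= !expnS; nia.
Qed.

(** * Dissimilar words *)

Definition dissimilar (A : finType) (t : nat -> nat) (w : seq A) : Prop :=
  forall u x x' v, w = u ++ x ++ x' ++ v -> size x = size x' -> 0 < size x ->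
  lcs x x' < t (size x).
Arguments dissimilar {A} t w.

Lemma dissimilar_catl (A : finType) (t : nat -> nat) (w w' : seq A) :
  dissimilar t (w ++ w') -> dissimilar t w.
Proof.
by move=> dw u x x' v eqw; apply: (dw u x x' (v ++ w')); rewrite eqw -!catA.
Qed.

Lemma dissimilar_take (A : finType) (t : nat -> nat) (n : nat) (w : seq A) :
  dissimilar t w -> dissimilar t (take n w).
Proof. by rewrite -{1}(cat_take_drop n w); apply: dissimilar_catl. Qed.

(** A forbidden [x x'], with [x] a suffix of [u] and [x'] equal to [v].  The size
  test is needed because the truncated [size u - size v] would otherwise
  compare [v] with a shorter word. *)
Definition similar_end (A : finType) (t : nat -> nat) (u v : seq A) : bool :=
  (size v <= size u) && (t (size v) <= lcs (drop (size u - size v) u) v).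
Arguments similar_end {A} t u v.

(** A forbidden factor that avoids the last letter would already occur in
  [take n w], so it is a suffix [x x'] of [w].  Here [i = size x - 1], which
  makes the part of [w] before [x'] have length [n - i] with [i] ranging from
  0; this part is a prefix of [take n w], hence dissimilar. *)
Lemma similar_end_extension (A : finType) (t : nat -> nat) (n : nat)
    (w : seq A) :
  size w = n.+1 -> dissimilar t (take n w) -> ~ dissimilar t w ->
  exists2 i, i < n.+1 & dissimilar t (take (n - i) w) /\
    similar_end t (take (n - i) w) (drop (n - i) w).
Proof.
move=> szw dw.
move=> /existsNP[u] /existsNP[x] /existsNP[x'] /existsNP[v].
move=> /not_implyP[eqw /not_implyP[szx]] /not_implyP[x0 /negP].
rewrite -leqNgt => sim.
case/lastP: v eqw => [|v c] eqw; last first.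
  rewrite leqNgt in sim; case/negP: sim; apply: (dw u x x' v) => //.
  move: szw; rewrite eqw -rcons_cat -rcons_cat -rcons_cat size_rcons => -[<-].
  by rewrite -cats1 take_size_cat.
rewrite cats0 catA in eqw.
have szux : size (u ++ x) = n - (size x).-1.
  by have := congr1 size eqw; rewrite !size_cat szw; lia.
exists (size x).-1.
  by have := congr1 size eqw; rewrite !size_cat szw; lia.
rewrite -szux eqw take_size_cat// drop_size_cat//; split.
  rewrite -[u ++ x](take_size_cat x' (erefl _)) -eqw szux.
  suff -> : take (n - (size x).-1) w = take (n - (size x).-1) (take n w).
    exact: dissimilar_take.
  by rewrite take_takel// leq_subr.
rewrite /similar_end -szx size_cat leq_addl /= addnK drop_size_cat//.
Qed.

Definition dissimilar_count (A : finType) (t : nat -> nat) : nat -> nat :=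
  word_count (fun w : seq A => `[< dissimilar t w >]).

Lemma word_count_similar_end (A : finType) (t : nat -> nat) (u : seq A)
    (m : nat) : 16 ^ m <= #|A| ^ t m ->
  word_count (similar_end t u) m * 4 ^ m <= #|A| ^ m.
Proof.
move=> t_large; have [lt_um|le_mu] := ltnP (size u) m.
  rewrite [word_count _ _]eq_card0// => v.
  by rewrite !inE /similar_end size_tuple leqNgt lt_um.
pose x := drop (size u - m) u.
have szx : size x = m by rewrite size_drop subKn.
have -> : word_count (similar_end t u) m =
    word_count (fun v => t m <= lcs x v) m.
  by apply: eq_card => v; rewrite !inE /similar_end size_tuple le_mu.
have le_c := word_count_lcs_ge A (t m) m x szx.
rewrite -(leq_pmul2l (expn_gt0 4 m)) mulnCA -expnMn.
by apply: leq_trans le_c; rewrite leq_mul2l t_large orbT.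
Qed.

(** The rate [#|A| / 2] reproduces itself: if it holds below [n], the extensions
  of dissimilar words of length [n] that fail because of a half of length
  [i.+1] are at most a fraction [2 ^ - i.+2] of all extensions, in total at
  most one half. *)
Lemma dissimilar_count_growth (A : finType) (t : nat -> nat) (n : nat) :
  (forall m, 16 ^ m <= #|A| ^ t m) ->
  #|A| * dissimilar_count A t n <= 2 * dissimilar_count A t n.+1.
Proof.
move=> t_large; set S := dissimilar_count A t.
elim/ltn_ind: n => n IHn.
have iter_growth i : i <= n -> #|A| ^ i * S (n - i) <= 2 ^ i * S n.
  elim: i => [|i IHi] lti; first by rewrite subn0.
  have lt_sub : n - i.+1 < n by rewrite ltn_subrL (leq_trans _ lti).
  have := IHn _ lt_sub; rewrite -subSn// subSS => step.
  rewrite expnS (mulnC #|A|) -mulnA.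
  apply: leq_trans (leq_mul (leqnn _) step) _.
  by rewrite mulnCA expnS -mulnA leq_mul2l IHi ?orbT// ltnW.
pose B i (w : seq A) := `[< dissimilar t (take (n - i) w) >] &&
  similar_end t (take (n - i) w) (drop (n - i) w).
have prefixS : word_count (fun w : seq A => `[< dissimilar t (take n w) >])
    n.+1 = S n * #|A|.
  have := word_count_cat A (fun w : seq A => `[< dissimilar t w >])
    (fun _ _ => true) n 1.
  rewrite addn1 => cat_eq.
  transitivity (word_count (fun w : seq A =>
      `[< dissimilar t (take n w) >] && true) n.+1).
    by apply: eq_card => w; rewrite !inE andbT.
  rewrite cat_eq [in LHS]/word_count sum_nat_const; congr (_ * _).
  by rewrite card_tuple.
have B_small i : i < n.+1 -> word_count (B i) n.+1 * 2 ^ i.+2 <= #|A| * S n.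
  rewrite ltnS => le_in.
  have -> : word_count (B i) n.+1 = word_count (B i) ((n - i) + i.+1).
    by rewrite addnS subnK.
  have -> := word_count_cat A (fun w : seq A => `[< dissimilar t w >])
    (similar_end t) (n - i) i.+1.
  (* Scaling by 2 ^ i turns the powers of 2 into the 4 ^ i.+1 of the bound on
     similar ends, and the other side into the iterated growth. *)
  rewrite -(leq_pmul2r (expn_gt0 2 i)) -mulnA -expnD.
  have -> : 2 ^ (i.+2 + i) = 4 ^ i.+1.
    by rewrite (_ : 4 = 2 ^ 2)// -expnM; congr (2 ^ _); lia.
  rewrite big_distrl /=.
  apply: leq_trans (_ : \sum_(u : (n - i).-tuple A | `[< dissimilar t u >])
    #|A| ^ i.+1 <= _).
    by apply: leq_sum => u _; apply: word_count_similar_end.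
  rewrite sum_nat_const.
  rewrite -/(word_count (fun w : seq A => `[< dissimilar t w >]) (n - i)).
  rewrite -/(dissimilar_count A t (n - i)) -/S.
  by rewrite mulnC expnS -!mulnA leq_mul2l (mulnC (S n)) iter_growth ?orbT.
have := geometric_sum_le _ _ _ B_small.
have : S n * #|A| <= S n.+1 + \sum_(i < n.+1) word_count (B i) n.+1.
  rewrite -prefixS.
  apply: word_count_union_bound => w szw /asboolP dw /asboolPn ndw.
  have [i lti [di si]] := similar_end_extension _ _ _ _ szw dw ndw.
  by exists i => //; apply/andP; split=> //; apply/asboolP.
by rewrite [S n * _]mulnC; lia.
Qed.

Lemma exists_dissimilar (A : finType) (t : nat -> nat) (n : nat) :
  (forall m, 16 ^ m <= #|A| ^ t m) ->
  exists2 w : seq A, size w = n & dissimilar t w.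
Proof.
move=> t_large.
have A0 : 0 < #|A|.
  have := t_large 1; rewrite expn1 lt0n; apply: contraTneq => ->.
  by case: (t 1) => // m; rewrite exp0n.
have : 0 < dissimilar_count A t n.
  elim: n => [|n IHn].
    rewrite /dissimilar_count /word_count; apply/card_gt0P; exists [tuple].
    rewrite inE.
    by move=> [|a u] [|a' x] x' v.
  by have := dissimilar_count_growth A t n t_large; move: A0 IHn; nia.
rewrite /dissimilar_count /word_count => /card_gt0P[w]; rewrite inE => dw.
by exists w; rewrite ?size_tuple.
Qed.

(** * From finite words to an infinite word *)

(** König's lemma: the words with arbitrarily long extensions satisfying [P]
  form a tree without leaves, because the alphabet is finite; any branch will
  do. *)
Lemma konig_words (A : finType) (P : seq A -> Prop) :
  (forall w w', P (w ++ w') -> P w) ->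
  (forall n, exists2 w, size w = n & P w) ->
  exists z : nat -> A, forall n, P (mkseq z n).
Proof.
move=> Pcat Pn.
pose ext u := forall n, exists2 v, size v = n & P (u ++ v).
have ext_rcons u : exists c, ext u -> ext (rcons u c).
  have [c0 _] : exists c : A, True by have [[|c w]] := Pn 1 => //; exists c.
  apply: contrapT => /forallNP noext.
  have extu : ext u by apply: contrapT => next; apply: (noext c0) => /next.
  have /choice[N NP] : forall c, exists n,
      ~ exists2 v, size v = n & P (rcons u c ++ v).
    by move=> c; apply/existsNP => extc; apply: (noext c).
  (* An extension longer than every [N c] contradicts [N] at its own letter. *)
  have [[//|c v] [szv] Puv] := extu (\max_c N c).+1.
  apply: (NP c); exists (take (N c) v).
    by rewrite size_takel// szv leq_bigmax.
  by apply: (Pcat _ (drop (N c) v)); rewrite -catA cat_take_drop cat_rcons.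
have [f fP] := choice ext_rcons.
pose pre n := iter n (fun u => rcons u (f u)) [::].
exists (fun n => f (pre n)) => n.
have -> : mkseq (fun n => f (pre n)) n = pre n.
  by elim: n => //= n IHn; rewrite mkseqS IHn.
have : ext (pre n) by elim: n => [|n IHn]; [exact: Pn | exact: fP].
by case/(_ 0) => v _; apply: Pcat.
Qed.

(** Raising the hypothesis to the power [alpha] gives [16 <= k `^ alpha], and the
  exponent on the right is larger than [alpha * m]. *)
Lemma threshold_large (R : realType) (alpha : R) (k m : nat) :
  (0 < alpha -> 16%:R `^ (1 / alpha) < k%:R ->
  (16 ^ m <= k ^ (Num.truncn (alpha * m%:R)).+1)%N)%R.
Proof.
move=> a0 hk.
have a_neq0 : (alpha != 0)%R by rewrite lt0r_neq0.
have k1 : (1 <= k%:R :> R)%R.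
  by rewrite (ler_nat R 1) -(ltr0n R) (le_lt_trans _ hk) ?powR_ge0.
have le16 : (16%:R <= k%:R `^ alpha :> R)%R.
  have -> : (16%:R = 16%:R `^ (1 / alpha * alpha) :> R)%R.
    by rewrite divfK// powRr1.
  rewrite powRrM.
  by apply: ge0_ler_powR; rewrite ?nnegrE ?powR_ge0 ?ler0n ?(ltW a0) ?(ltW hk).
rewrite -(ler_nat R) !natrX -!powR_mulrn//.
apply: le_trans (_ : (k%:R `^ alpha) `^ m%:R <= _)%R.
  by apply: ge0_ler_powR; rewrite ?nnegrE ?powR_ge0.
by rewrite -powRrM; apply: ler_powR => //; rewrite ltW// truncnS_gt.
Qed.

Local Open Scope ring_scope.

Theorem theorem1 (R : realType) (alpha : R) (k : nat)
    (halpha0 : 0 < alpha) (halpha1 : alpha < 1)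
    (hk : 16%:R `^ (1 / alpha) < k%:R) :
  exists z : nat -> 'I_k, sc R z <= alpha.
Proof.
pose t m := (Num.truncn (alpha * m%:R)).+1.
have t_large m : (16 ^ m <= #|'I_k| ^ t m)%N.
  by rewrite card_ord; apply: threshold_large.
have [z zP] := konig_words 'I_k _ (dissimilar_catl 'I_k t)
  (fun n => exists_dissimilar 'I_k t n t_large).
exists z; apply: ge_sup; first by case: (has_sup_similarities R z).
move=> _ [x [x' [[i eqxx'] szx x0 ->]]].
have prefix_z : mkseq z (i + size (x ++ x')) = mkseq z i ++ x ++ x' ++ [::].
  rewrite cats0 [in RHS]eqxx' /mkseq iotaD add0n map_cat.
  by rewrite -[in iota i _](addn0 i) iotaDl -map_comp.
have := zP _ _ _ _ _ prefix_z szx x0.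
rewrite /t ltnS truncn_ge_nat ?mulr_ge0 ?ler0n ?(ltW halpha0)// => le_lcs.
by rewrite /similarity ler_pdivrMr ?ltr0n.
Qed.
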